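(* The category $\mathsf{mSp}$ of $mS$-spaces with monotone meet-relations and the category $\mathsf{mMS}$ of monotone semilattices with monotone homomorphisms are dually equivalent.
   Context: A semilattice is a meet-semilattice with greatest element $\langle A,\wedge,1\rangle$; homomorphisms preserve $\wedge$ and $1$. A monotone semilattice is a pair $\langle \mathbf{A},m\rangle$ with $\mathbf{A}$ a semilattice and $m\colon A\to A$ order preserving; a monotone homomorphism $h\colon\langle\mathbf{A},m\rangle\to\langle\mathbf{B},n\rangle$ is a semilattice homomorphism with $h(ma)=nh(a)$ for all $a$. These form the category $\mathsf{mMS}$. Topological spaces are given as pairs $\langle X,\mathcal{K}\rangle$ where $\mathcal{K}$ is a subbase of the topology. Put $S(X)=\{U^c\colon U\in\mathcal{K}\}$ and $C_\mathcal{K}(X)=\{\bigcap\mathcal{A}\colon \mathcal{A}\subseteq S(X)\}$. For $Y\subseteq X$, a family $\mathcal{Z}\subseteq S(X)$ is a $Y$-family if for all $A,B\in\mathcal{Z}$ there exist $H\in S(X)$ and $C\in\mathcal{Z}$ with $Y\subseteq H$, $A\cap H\subseteq C$, $B\cap H\subseteq C$. An $S$-space is $\langle X,\mathcal{K}\rangle$ such that: (S1) it is $T_0$ and $X=\bigcup\mathcal{K}$; (S2) $\mathcal{K}$ consists of compact open sets, is closed under finite unions and $\emptyset\in\mathcal{K}$; (S3) for $U,V\in\mathcal{K}$ and $x\in U\cap V$ there exist $W,D\in\mathcal{K}$ with $x\notin W$, $x\in D$, $D\subseteq (U\cap V)\cup W$; (S4) if $Y\in C_\mathcal{K}(X)$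 and $\mathcal{J}\subseteq S(X)$ is a $Y$-family with $Y\cap A^c\neq\emptyset$ for all $A\in\mathcal{J}$, then $Y\cap\bigcap\{A^c\colon A\in\mathcal{J}\}\neq\emptyset$. Then $\langle S(X),\cap,X\rangle$ is a semilattice. A subset $Z\subseteq X$ is subbasic saturated if $Z=\bigcap\mathcal{L}$ for some dually directed family $\mathcal{L}\subseteq\mathcal{K}$ (for $U,V\in\mathcal{L}$ there is $W\in\mathcal{L}$ with $W\subseteq U\cap V$); $\mathcal{Z}(X)$ denotes their set. For $U\in S(X)$ let $L_U=\{Z\in\mathcal{Z}(X)\colon Z\cap U\ne\emptyset\}$. An $mS$-space is $\langle X,\mathcal{K},R\rangle$ with $\langle X,\mathcal{K}\rangle$ an $S$-space and $R\subseteq X\times\mathcal{Z}(X)$ such that (1) $m_R(U)=\{x\in X\colon \forall Z\in R(x)\,[Z\cap U\neq\emptyset]\}\in S(X)$ for all $U\in S(X)$, and (2) $R(x)=\bigcap\{L_U\colon U\in S(X),\ x\in m_R(U)\}$ for all $x\in X$. For $S$-spaces $X_1,X_2$, a meet-relation is $T\subseteq X_1\times X_2$ such that $\Box_T(U)=\{x\colon T(x)\subseteq U\}\in S(X_1)$ for all $U\in S(X_2)$ and $T(x)=\bigcap\{U\in S(X_2)\colon T(x)\subseteq U\}$ for all $x\in X_1$. Between $mS$-spaces $\langle X_i,\mathcal{K}_i,R_i\rangle$, a meet-relation $T$ is monotone if $m_{R_1}\circ\Box_T=\Box_T\circ m_{R_2}$ on $S(X_2)$. Composition of $R\subseteq X_1\times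 X_2$ and $T\subseteq X_2\times X_3$ is $T\ast R=\{(x,z)\colon \forall U\in S(X_3)\,[(T\circ R)(x)\subseteq U\Rightarrow z\in U]\}$, and the identity on $X$ is the dual $\sqsupseteq$ of the specialization order ($x\sqsubseteq y$ iff $x\in\mathrm{cl}(y)$). $mS$-spaces with monotone meet-relations, this composition and these identities form the category $\mathsf{mSp}$.
   Formalization: In (S4) the Y-family J is required to be nonempty; with J empty, (S4) would force every member of C_K(X) to be nonempty, while (S1) puts the empty set in C_K(X), so no S-space would exist. *)

(* Defs.v *)
From mathcomp Require Import all_boot all_order.
From mathcomp Require Import finmap boolp classical_sets functions filter topology.

Set Implicit Arguments.
Unset Strict Implicit.
Unset Printing Implicit Defensive.

Local Open Scope classical_set_scope.

(* Composition is written in diagrammatic order: comp f g is "f, then g". *)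
Record category := Category {
  Ob :> Type;
  Hom : Ob -> Ob -> Type;
  idm : forall x, Hom x x;
  comp : forall x y z, Hom x y -> Hom y z -> Hom x z;
  comp1m : forall x y (f : Hom x y), comp (idm x) f = f;
  compm1 : forall x y (f : Hom x y), comp f (idm y) = f;
  compA : forall x y z t (f : Hom x y) (g : Hom y z) (h : Hom z t),
    comp f (comp g h) = comp (comp f g) h }.
Arguments Hom {c}.
Arguments idm {c}.
Arguments comp {c x y z}.

Definition opposite (C : category) : category :=
  @Category C (fun x y => Hom y x) idm (fun x y z f g => comp g f)
    (fun x y f => compm1 f) (fun x y f => comp1m f)
    (fun x y z t f g h => esym (compA h g f)).

Record functor (C D : category) := Functor {
  fob :> C -> D;
  fhom : forall x y, Hom x y -> Hom (fob x) (fob y);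
  fhom1 : forall x, fhom (idm x) = idm (fob x);
  fhomM : forall x y z (f : Hom x y) (g : Hom y z),
    fhom (comp f g) = comp (fhom f) (fhom g) }.
Arguments fhom {C D} _ {x y}.

Definition id_functor (C : category) : functor C C :=
  @Functor C C id (fun _ _ => id) (fun=> erefl) (fun _ _ _ _ _ => erefl).

Section functor_comp.
Variables (C D E : category) (F : functor C D) (G : functor D E).

Lemma functor_comp1 x : fhom G (fhom F (idm x)) = idm (G (F x)).
Proof. by rewrite !fhom1. Qed.

Lemma functor_compM x y z (f : Hom x y) (g : Hom y z) :
  fhom G (fhom F (comp f g)) = comp (fhom G (fhom F f)) (fhom G (fhom F g)).
Proof. by rewrite !fhomM. Qed.

Definition functor_comp : functor C E :=
  @Functor C E (fun x => G (F x)) (fun x y f => fhom G (fhom F f))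
    functor_comp1 functor_compM.
End functor_comp.

Definition is_iso (C : category) (x y : C) (f : Hom x y) :=
  exists2 g : Hom y x, comp f g = idm x & comp g f = idm y.

Definition naturally_isomorphic (C D : category) (F G : functor C D) :=
  exists eta : forall x : C, Hom (F x) (G x),
    (forall x y (f : Hom x y),
       comp (fhom F f) (eta y) = comp (eta x) (fhom G f)) /\
    (forall x, is_iso (eta x)).

Definition equivalent (C D : category) :=
  exists (F : functor C D) (G : functor D C),
    naturally_isomorphic (functor_comp F G) (id_functor C) /\
    naturally_isomorphic (functor_comp G F) (id_functor D).

Definition dually_equivalent (C D : category) := equivalent (opposite C) D.

Lemma sig_eq T (P : T -> Prop) (u v : {x | P x}) : sval u = sval v -> u = v.
Proof.
case: u v => [x Px] [y Py] /= xy; case: _ / xy Py => Py.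
by congr exist; apply: Prop_irrelevance.
Qed.

(* The display of the underlying order is only a notational tag. *)
Record monotone_semilattice := MonotoneSemilattice {
  msl_disp : Order.disp_t;
  msl_sort :> tMeetSemilatticeType msl_disp;
  msl_op : msl_sort -> msl_sort;
  msl_opP : {homo msl_op : a b / (a <= b)%O} }.

Definition monotone_hom (A B : monotone_semilattice) (h : A -> B) :=
  [/\ {morph h : a b / (Order.meet a b)},
      h (\top)%O = (\top)%O
    & forall a, h (msl_op a) = msl_op (h a)].

Lemma monotone_hom_id (A : monotone_semilattice) : monotone_hom (@id A).
Proof. by []. Qed.

Lemma monotone_hom_comp (A B C : monotone_semilattice) (f : A -> B)
  (g : B -> C) : monotone_hom f -> monotone_hom g -> monotone_hom (g \o f).
Proof.
move=> [fI f1 fm] [gI g1 gm].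
by split=> [a b||a] /=; rewrite ?fI ?gI ?f1 ?g1 ?fm ?gm.
Qed.

Definition mMS_hom (A B : monotone_semilattice) := {h : A -> B | monotone_hom h}.

Definition mMS_id A : mMS_hom A A := exist _ id (monotone_hom_id A).

Definition mMS_comp A B C (f : mMS_hom A B) (g : mMS_hom B C) : mMS_hom A C :=
  exist _ (sval g \o sval f) (monotone_hom_comp (svalP f) (svalP g)).

Lemma mMS_comp1m A B (f : mMS_hom A B) : mMS_comp (mMS_id A) f = f.
Proof. exact: sig_eq. Qed.

Lemma mMS_compm1 A B (f : mMS_hom A B) : mMS_comp f (mMS_id B) = f.
Proof. exact: sig_eq. Qed.

Lemma mMS_compA A B C D (f : mMS_hom A B) (g : mMS_hom B C) (h : mMS_hom C D) :
  mMS_comp f (mMS_comp g h) = mMS_comp (mMS_comp f g) h.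
Proof. exact: sig_eq. Qed.

Definition mMS : category := Category mMS_comp1m mMS_compm1 mMS_compA.

Section subbases.
Variables (X : topologicalType) (K : set (set X)).

(* finI_from K id includes the empty intersection setT. *)
Definition subbase :=
  open = [set \bigcup_(B in F) B | F in subset^~ (finI_from K id)].

Definition cosub : set (set X) := [set ~` U | U in K].

Definition subbasic_closed : set (set X) :=
  [set \bigcap_(A in F) A | F in subset^~ cosub].

Definition family_for (Y : set X) (F : set (set X)) :=
  F `<=` cosub /\
  forall A B, F A -> F B -> exists H C,
    [/\ cosub H, F C, Y `<=` H, A `&` H `<=` C & B `&` H `<=` C].

(* In S_family J must be nonempty: by S_cover, subbasic_closed contains set0,
   so that J = set0 and Y = set0 would violate it. *)
Record S_space : Prop := {
  S_subbase : subbase;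
  S_T0 : kolmogorov_space X;
  S_cover : \bigcup_(U in K) U = [set: X];
  S_compact_open : forall U, K U -> compact U /\ open U;
  S_setU : forall U V, K U -> K V -> K (U `|` V);
  S_set0 : K set0;
  S_irreducible : forall U V x, K U -> K V -> (U `&` V) x ->
    exists W D, [/\ K W, K D, ~ W x, D x & D `<=` (U `&` V) `|` W];
  S_family : forall Y J, subbasic_closed Y -> J !=set0 -> family_for Y J ->
    (forall A, J A -> Y `&` ~` A !=set0) ->
    Y `&` \bigcap_(A in J) ~` A !=set0 }.

Definition dually_directed (L : set (set X)) :=
  forall U V, L U -> L V -> exists2 W, L W & W `<=` U `&` V.

Definition subbasic_saturated : set (set X) :=
  [set Z | exists L, [/\ L `<=` K, dually_directed L &
                         Z = \bigcap_(U in L) U]].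

Definition hits (U : set X) : set (set X) :=
  [set Z | subbasic_saturated Z /\ Z `&` U !=set0].

Definition mrel (R : X -> set (set X)) (U : set X) : set X :=
  [set x | forall Z, R x Z -> Z `&` U !=set0].

(* A relation R between X and the subbasic saturated sets is the map x |-> R(x).
   The intersection in mS_fix is taken within subbasic_saturated, which is its
   value when x belongs to no mrel R U. *)
Record mS_space (R : X -> set (set X)) : Prop := {
  mS_S : S_space;
  mS_sat : forall x, R x `<=` subbasic_saturated;
  mS_cosub : forall U, cosub U -> cosub (mrel R U);
  mS_fix : forall x, R x =
    subbasic_saturated `&`
    \bigcap_(U in [set U | cosub U /\ mrel R U x]) hits U }.

End subbases.

Section relations.
Variables X1 X2 : topologicalType.
Variables (K1 : set (set X1)) (K2 : set (set X2)).

Definition box (T : X1 -> set X2) (U : set X2) : set X1 :=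
  [set x | T x `<=` U].

Definition meet_relation (T : X1 -> set X2) :=
  (forall U, cosub K2 U -> cosub K1 (box T U)) /\
  (forall x, T x = \bigcap_(U in [set U | cosub K2 U /\ T x `<=` U]) U).

Definition monotone_meet_relation (R1 : X1 -> set (set X1))
    (R2 : X2 -> set (set X2)) (T : X1 -> set X2) :=
  meet_relation T /\
  forall U, cosub K2 U -> mrel R1 (box T U) = box T (mrel R2 U).
End relations.

Definition rel_comp (X1 X2 X3 : Type) (T : X2 -> set X3) (R : X1 -> set X2) :
  X1 -> set X3 := fun x => [set z | exists2 y, R x y & T y z].

Definition star (X1 X2 : Type) (X3 : topologicalType) (K3 : set (set X3))
    (T : X2 -> set X3) (R : X1 -> set X2) : X1 -> set X3 :=
  fun x => [set z | forall U, cosub K3 U -> rel_comp T R x `<=` U -> U z].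

Definition specialization (X : topologicalType) (x y : X) :=
  closure [set y] x.

Definition dual_specialization (X : topologicalType) : X -> set X :=
  fun x => [set y | specialization y x].

Record mSspace := MSSpace {
  ms_sort :> topologicalType;
  ms_sub : set (set ms_sort);
  ms_rel : ms_sort -> set (set ms_sort);
  ms_axiom : mS_space ms_sub ms_rel }.

Definition mS_morphism (X Y : mSspace) (T : X -> set Y) :=
  monotone_meet_relation (@ms_sub X) (@ms_sub Y) (@ms_rel X) (@ms_rel Y) T.

Lemma S_cosub_closed (X : topologicalType) (K : set (set X)) :
  S_space K -> forall U, cosub K U -> closed U.
Proof.
by move=> SK _ [U KU <-]; apply: open_closedC; case: (S_compact_open SK KU).
Qed.

Lemma dual_specializationE (X : topologicalType) (K : set (set X)) :
  S_space K -> forall x : X,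
  dual_specialization x = \bigcap_(U in [set U | cosub K U /\ U x]) U.
Proof.
move=> SK x; apply/seteqP; split=> [y /= yx U [SU Ux]|y /= yU B].
  have := S_cosub_closed SK SU; apply; apply: (closureS _ yx).
  by move=> _ ->.
rewrite nbhsE => -[O [Oo Oy] OB]; exists x; split=> //; apply: OB.
move: Oo Oy; rewrite (S_subbase SK) => -[F FK <-] [A FA Ay]; exists A => //.
have [D DK DA] := FK _ FA; rewrite -DA in Ay *.
move=> V DV /=; apply: contrapT => Vx.
have KV : K V by have := DK _ DV; rewrite inE.
by have /= := yU (~` V) (conj (ex_intro2 _ _ V KV erefl) Vx); apply; apply: Ay.
Qed.

Lemma box_dual_specialization (X : topologicalType) (K : set (set X)) :
  S_space K -> forall U, cosub K U -> box (@dual_specialization X) U = U.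
Proof.
move=> SK U SU; apply/seteqP; split=> x /=.
  by apply; rewrite (dual_specializationE SK) => V [].
by move=> Ux y; rewrite (dual_specializationE SK); apply.
Qed.

Lemma mS_morphism_id (X : mSspace) : mS_morphism (@dual_specialization X).
Proof.
have mSX := @ms_axiom X; have SX := mS_S mSX.
split=> [|U SU].
  split=> [U SU|x]; first by rewrite (box_dual_specialization SX).
  rewrite {1}(dual_specializationE SX); congr (\bigcap_(U in _) U).
  apply/seteqP; split=> U [SU HU]; split=> //.
    by move: HU; rewrite -{1}(box_dual_specialization SX SU).
  by rewrite -(box_dual_specialization SX SU).
by rewrite !(box_dual_specialization SX) //; apply: (mS_cosub mSX).
Qed.

Lemma box_star (X1 X2 X3 : topologicalType) (K3 : set (set X3))
    (T : X2 -> set X3) (R : X1 -> set X2) U :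
  cosub K3 U -> box (star K3 T R) U = box R (box T U).
Proof.
move=> SU; apply/seteqP; split=> x /=.
  by move=> TRU y Rxy z Tyz; apply: TRU => V SV; apply; exists y.
by move=> RTU z; apply=> // t [y Rxy]; apply: RTU.
Qed.

Lemma meet_relation_eq (X1 X2 : topologicalType) (K1 : set (set X1))
    (K2 : set (set X2)) (T T' : X1 -> set X2) :
  meet_relation K1 K2 T -> meet_relation K1 K2 T' ->
  (forall U, cosub K2 U -> box T U = box T' U) -> T = T'.
Proof.
move=> [_ TE] [_ T'E] TT'; apply/funext => x; rewrite TE T'E.
congr (\bigcap_(U in _) U); apply/seteqP; split=> U [SU TU]; split=> //.
  by have : box T U x by []; rewrite TT'.
by have : box T' U x by []; rewrite -TT'.
Qed.

Lemma mS_morphism_star (X Y Z : mSspace) (R : X -> set Y) (T : Y -> set Z) :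
  mS_morphism R -> mS_morphism T -> mS_morphism (star (@ms_sub Z) T R).
Proof.
move=> [[RS RE] Rm] [[TS TE] Tm]; split=> [|U SU].
  split=> [U SU|x]; first by rewrite box_star//; apply/RS/TS.
  apply/seteqP; split=> z.
    by move=> sz U [SU sU]; apply: sU.
  by move=> + U SU cU; apply; split=> // t; apply.
by rewrite !box_star ?Rm ?Tm //; [exact: TS|exact: (mS_cosub (@ms_axiom Z))].
Qed.

Definition mSp_hom (X Y : mSspace) := {T : X -> set Y | mS_morphism T}.

Definition mSp_id X : mSp_hom X X :=
  exist _ (@dual_specialization X) (mS_morphism_id X).

Definition mSp_comp X Y Z (R : mSp_hom X Y) (T : mSp_hom Y Z) : mSp_hom X Z :=
  exist _ (star (@ms_sub Z) (sval T) (sval R))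
    (mS_morphism_star (svalP R) (svalP T)).

Lemma mSp_hom_eq (X Y : mSspace) (T T' : mSp_hom X Y) :
  (forall U, cosub (@ms_sub Y) U -> box (sval T) U = box (sval T') U) -> T = T'.
Proof.
move=> TT'; apply: sig_eq.
exact: (meet_relation_eq (svalP T).1 (svalP T').1).
Qed.

Lemma mSp_comp1m X Y (T : mSp_hom X Y) : mSp_comp (mSp_id X) T = T.
Proof.
apply: mSp_hom_eq => U SU /=; rewrite box_star//.
have [[TS _] _] := svalP T.
by rewrite (box_dual_specialization (mS_S (@ms_axiom X)))//; apply: TS.
Qed.

Lemma mSp_compm1 X Y (T : mSp_hom X Y) : mSp_comp T (mSp_id Y) = T.
Proof.
apply: mSp_hom_eq => U SU /=; rewrite box_star//.
by rewrite (box_dual_specialization (mS_S (@ms_axiom Y))).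
Qed.

Lemma mSp_compA X Y Z W (f : mSp_hom X Y) (g : mSp_hom Y Z) (h : mSp_hom Z W) :
  mSp_comp f (mSp_comp g h) = mSp_comp (mSp_comp f g) h.
Proof.
apply: mSp_hom_eq => U SU /=.
by rewrite !box_star//; have [[+ _] _] := svalP h; apply.
Qed.

Definition mSp : category := Category mSp_comp1m mSp_compm1 mSp_compA.

(* Main.v *)
(* The functor S sending an mS-space X to the semilattice S(X) with the operation
   m_R, and a meet-relation T to the map Box_T, is fully faithful and essentially
   surjective. For fullness, a homomorphism h : S(Y) -> S(X) is Box_T for
   T(x) = \bigcap {U | x \in h U}: by compactness of the members of the subbase,
   when x \notin h U the filter {V | x \in h V} has a common point outside U.
   For essential surjectivity, a monotone semilattice A is isomorphic to S(X(A)),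
   where X(A) is the space of irreducible filters of A; the subbasic sets
   ~` beta a are themselves subbasic saturated, and they suffice to recover m
   from the relation on X(A). *)
From HB Require Import structures.
From mathcomp Require Import all_boot all_order.
From mathcomp Require Import boolp classical_sets filter topology.
Require Import Defs.

Set Implicit Arguments.
Unset Strict Implicit.
Unset Printing Implicit Defensive.

Import Order.TTheory.
Local Open Scope classical_set_scope.

(** * Fully faithful and essentially surjective functors *)

Section fully_faithful.
Variables (C D : category) (F : functor C D).
Hypothesis F_faithful : forall x y, injective (@fhom C D F x y).
Hypothesis F_full : forall x y (g : Hom (F x) (F y)), exists f, fhom F f = g.
Hypothesis F_esurj : forall d, exists c (f : Hom d (F c)), is_iso f.

Let inv_ob d : C := projT1 (cid (F_esurj d)).

Let unit d : Hom d (F (inv_ob d)) := projT1 (cid (projT2 (cid (F_esurj d)))).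

Let unit_iso d : is_iso (unit d) :=
  projT2 (cid (projT2 (cid (F_esurj d)))).

Let counit d : Hom (F (inv_ob d)) d := s2val (cid2 (unit_iso d)).

Let unitK d : comp (unit d) (counit d) = idm d.
Proof. exact: s2valP (cid2 (unit_iso d)). Qed.

Let counitK d : comp (counit d) (unit d) = idm _.
Proof. exact: s2valP' (cid2 (unit_iso d)). Qed.

Let lift x y (g : Hom (F x) (F y)) : Hom x y := projT1 (cid (F_full g)).

Let liftK x y (g : Hom (F x) (F y)) : fhom F (lift g) = g.
Proof. exact: projT2 (cid (F_full g)). Qed.

(** The conjugate of [g] by the chosen isomorphisms, pulled back along [F]; faithfulness reduces the
    functor laws to identities in [D]. *)
Let inv_hom d e (g : Hom d e) : Hom (inv_ob d) (inv_ob e) :=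
  lift (comp (comp (counit d) g) (unit e)).

Let inv_hom1 d : inv_hom (idm d) = idm (inv_ob d).
Proof. by apply: F_faithful; rewrite liftK compm1 counitK fhom1. Qed.

Let inv_homM d e k (f : Hom d e) (g : Hom e k) :
  inv_hom (comp f g) = comp (inv_hom f) (inv_hom g).
Proof.
apply: F_faithful; rewrite fhomM !liftK -!compA; congr (comp _ (comp _ _)).
by rewrite [RHS]compA unitK comp1m.
Qed.

Let inverse : functor D C := Functor inv_hom1 inv_homM.

Lemma fully_faithful_equivalent : equivalent C D.
Proof.
exists F, inverse; split.
  exists (fun x => lift (counit (F x))); split=> [x y f|x].
    apply: F_faithful; rewrite /= !fhomM !liftK -compA.
    by rewrite unitK compm1.
  exists (lift (unit (F x))); apply: F_faithful;
    by rewrite fhomM !liftK fhom1 ?counitK ?unitK.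
exists counit; split=> [d e g|d].
  by rewrite /= liftK -compA unitK compm1.
by exists (unit d); [exact: counitK|exact: unitK].
Qed.
End fully_faithful.

(** * The semilattice of an S-space *)

Lemma mrel_subset (X : topologicalType) (R : X -> set (set X)) (U V : set X) :
  U `<=` V -> mrel R U `<=` mrel R V.
Proof. by move=> UV x RU Z /RU [z [Zz Uz]]; exists z; split=> //; exact: UV. Qed.

Definition cosub_type (X : mSspace) := {U : set X | cosub (@ms_sub X) U}.

HB.instance Definition _ (X : mSspace) := gen_eqMixin (cosub_type X).
HB.instance Definition _ (X : mSspace) := gen_choiceMixin (cosub_type X).

Section cosub_semilattice.
Variable X : mSspace.
Implicit Types U V W : cosub_type X.

Let SX : S_space (@ms_sub X) := mS_S (@ms_axiom X).

Definition cosub_le U V := `[< sval U `<=` sval V >].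

Lemma cosub_le_refl : reflexive cosub_le.
Proof. by move=> U; apply/asboolP. Qed.

Lemma cosub_le_anti : antisymmetric cosub_le.
Proof. by move=> U V /andP[/asboolP UV /asboolP VU]; apply/sig_eq/seteqP. Qed.

Lemma cosub_le_trans : transitive cosub_le.
Proof.
move=> V U W /asboolP UV /asboolP VW; apply/asboolP; exact: subset_trans VW.
Qed.

HB.instance Definition _ := Order.Le_isPOrder.Build (Order.Disp tt tt)
  (cosub_type X) cosub_le_refl cosub_le_anti cosub_le_trans.

Lemma cosub_setI (A B : set X) :
  cosub (@ms_sub X) A -> cosub (@ms_sub X) B -> cosub (@ms_sub X) (A `&` B).
Proof.
move=> [U KU <-] [V KV <-]; exists (U `|` V); first exact: (S_setU SX).
by rewrite setCU.
Qed.

Lemma cosub_setT : cosub (@ms_sub X) setT.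
Proof. by exists set0; [exact: (S_set0 SX)|rewrite setC0]. Qed.

Definition cosub_meet U V : cosub_type X :=
  exist _ (sval U `&` sval V) (cosub_setI (svalP U) (svalP V)).

Definition cosub_top : cosub_type X := exist _ setT cosub_setT.

Lemma cosub_lexI U V W :
  cosub_le U (cosub_meet V W) = cosub_le U V && cosub_le U W.
Proof.
apply/asboolP/andP; rewrite /= subsetI => -[].
  by move=> UV UW; split; apply/asboolP.
by move=> /asboolP UV /asboolP UW.
Qed.

HB.instance Definition _ := Order.POrder_isMeetSemilattice.Build
  (Order.Disp tt tt) (cosub_type X) cosub_lexI.

Lemma cosub_lex1 U : cosub_le U cosub_top.
Proof. exact/asboolP. Qed.

HB.instance Definition _ := Order.hasTop.Build
  (Order.Disp tt tt) (cosub_type X) cosub_lex1.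

Definition cosub_op U : cosub_type X :=
  exist _ (mrel (@ms_rel X) (sval U)) (mS_cosub (@ms_axiom X) (svalP U)).

Lemma cosub_opP : {homo cosub_op : U V / (U <= V)%O}.
Proof. by move=> U V /asboolP UV; apply/asboolP/mrel_subset. Qed.

Definition cosub_mMS : mMS := MonotoneSemilattice cosub_opP.
End cosub_semilattice.

(** * The contravariant action of meet-relations *)

Section cosub_functor.
Variables (X Y : mSspace) (T : mSp_hom X Y).

Definition cosub_box (U : cosub_mMS Y) : cosub_mMS X :=
  exist _ (box (sval T) (sval U)) ((svalP T).1.1 _ (svalP U)).

Lemma cosub_box_hom : monotone_hom cosub_box.
Proof.
split=> [U V||U]; apply: sig_eq => /=.
- by apply/seteqP; split=> x; rewrite /box /= subsetI.
- by apply/seteqP; split.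
- by rewrite (svalP T).2//; exact: svalP.
Qed.

Definition cosub_hom : mMS_hom (cosub_mMS Y) (cosub_mMS X) :=
  exist _ cosub_box cosub_box_hom.
End cosub_functor.

Lemma cosub_hom1 (X : mSspace) : cosub_hom (mSp_id X) = mMS_id (cosub_mMS X).
Proof.
apply/sig_eq/funext => U; apply: sig_eq => /=.
exact: (box_dual_specialization (mS_S (@ms_axiom X)) (svalP U)).
Qed.

Lemma cosub_homM (X Y Z : mSspace) (R : mSp_hom X Y) (T : mSp_hom Y Z) :
  cosub_hom (mSp_comp R T) = mMS_comp (cosub_hom T) (cosub_hom R).
Proof.
apply/sig_eq/funext => U; apply: sig_eq => /=.
by rewrite box_star//; exact: svalP.
Qed.

Definition cosub_fun : functor (opposite mSp) mMS :=
  @Functor (opposite mSp) mMS cosub_mMS (fun X Y => @cosub_hom Y X)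
    cosub_hom1 (fun X Y Z f g => cosub_homM g f).

(** The values of a meet-relation are intersections of members of [cosub], so [box] on [cosub]
    determines it. *)
Lemma cosub_fun_faithful (X Y : opposite mSp) :
  injective (@fhom _ _ cosub_fun X Y).
Proof.
move=> T T' TT'; apply: mSp_hom_eq => U SU.
exact: (congr1 (fun h : mMS_hom (cosub_mMS X) (cosub_mMS Y) =>
  sval (sval h (exist _ U SU))) TT').
Qed.

(** The traces of the members of [G] on the complement of [U] generate a proper filter. That
    complement is compact, so it contains a cluster point, which lies in every member of [G] since
    these are closed. *)
Lemma cosub_filter_point (Y : mSspace) (G : set (cosub_mMS Y)) (U : cosub_mMS Y) :
  G (\top)%O -> (forall V W, G V -> G W -> G (Order.meet V W)) ->
  (forall V, G V -> ~ sval V `<=` sval U) ->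
  exists2 y, forall V, G V -> sval V y & ~ sval U y.
Proof.
move=> G1 GI GU; have SY := mS_S (@ms_axiom Y).
pose B (V : cosub_mMS Y) := sval V `&` ~` sval U.
have FF : Filter (filter_from G B).
  apply: filter_from_filter; first by exists (\top)%O.
  move=> V W GV GW; exists (Order.meet V W); first exact: GI.
  by move=> y [[Vy Wy] Uy].
have PF : ProperFilter (filter_from G B).
  apply: filter_from_proper => V /GU VU; apply: contrapT => VU0; apply: VU.
  by move=> y Vy; apply: contrapT => Uy; apply: VU0; exists y.
have [O KO OU] := svalP U.
have [|y [Uy cy]] := (S_compact_open SY KO).1 _ PF.
  by exists (\top)%O => // y []; rewrite -OU setCK.
exists y; last by rewrite -OU.
move=> V GV; apply: (S_cosub_closed SY (svalP V)) => N.
by apply: cy; exists V => // z [].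
Qed.

Section cosub_full.
Variables (X Y : mSspace) (h : mMS_hom (cosub_mMS Y) (cosub_mMS X)).

Definition hom_rel (x : X) : set Y :=
  [set y | forall U : cosub_mMS Y, sval (sval h U) x -> sval U y].

Lemma hom_homo (U V : cosub_mMS Y) :
  sval U `<=` sval V -> sval (sval h U) `<=` sval (sval h V).
Proof.
move=> UV; have [hI _ _] := svalP h.
have -> : U = Order.meet U V.
  by apply/esym/sig_eq/seteqP; split=> [y []//|y Uy]; split=> //; exact: UV.
by rewrite hI => x [].
Qed.

Lemma box_hom_rel (U : cosub_mMS Y) :
  box hom_rel (sval U) = sval (sval h U).
Proof.
have [hI h1 _] := svalP h.
apply/seteqP; split=> x /= => [TU|hUx y]; last exact.
apply: contrapT => hUx.
(* These [V] form a filter because [h] preserves top and meets; if one were included in [U],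
   monotonicity of [h] would put [x] in [h U]. *)
have [||V hVx VU|y hy] :=
  @cosub_filter_point Y [set V | sval (sval h V) x] U; first by rewrite /= h1.
- by move=> V W /= hVx hWx; rewrite hI.
- by apply: hUx; apply: (hom_homo VU).
- by apply; apply: TU.
Qed.

Lemma hom_rel_morphism : mS_morphism hom_rel.
Proof.
have [_ _ hm] := svalP h.
split=> [|U SU]; last first.
  (* [msl_op] on [cosub_mMS Y] is [mrel] on underlying sets, so the commutation is [hm] read through
     [box_hom_rel]. *)
  rewrite (box_hom_rel (exist _ U SU)).
  by rewrite (box_hom_rel (msl_op (exist _ U SU : cosub_mMS Y))) hm.
split=> [U SU|x]; first by rewrite (box_hom_rel (exist _ U SU)); exact: svalP.
apply/seteqP; split=> y /=; first by move=> Ty U [SU]; exact.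
move=> + U hUx; apply; split; first exact: svalP.
by move: hUx; rewrite -box_hom_rel.
Qed.
End cosub_full.

Lemma cosub_fun_full (X Y : opposite mSp) (h : Hom (cosub_fun X) (cosub_fun Y)) :
  exists f, fhom cosub_fun f = h.
Proof.
exists (exist _ (hom_rel h) (hom_rel_morphism h)).
by apply/sig_eq/funext => U; apply: sig_eq; exact: box_hom_rel.
Qed.

(** * The space of irreducible filters of a semilattice *)

Section irreducible_filters.
Variables (d : Order.disp_t) (A : tMeetSemilatticeType d).
Implicit Types (a b c f : A) (F P J : set A).
Local Open Scope order_scope.

Definition sl_filter F :=
  [/\ F \top, forall a b, F a -> F b -> F (a `&` b)
    & forall a b, a <= b -> F a -> F b].

(* For a proper filter P this says that P is meet-irreducible in the lattice of
   filters: P = F1 `&` F2 implies P = F1 or P = F2. *)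
Definition irreducible P :=
  [/\ sl_filter P, exists a, ~ P a
    & forall a b, ~ P a -> ~ P b ->
      exists f c, [/\ P f, ~ P c, a `&` f <= c & b `&` f <= c]].

(* The hypothesis on J is the algebraic form of a Y-family, with F the filter
   of Y. *)
Lemma irreducible_separation F J : sl_filter F -> J !=set0 ->
  (forall a b, J a -> J b ->
    exists f c, [/\ F f, J c, a `&` f <= c & b `&` f <= c]) ->
  (forall a, F a -> ~ J a) ->
  exists P, [/\ irreducible P, F `<=` P & forall a, P a -> ~ J a].
Proof.
move=> fF [j Jj] Jdir FJ.
(* The empty set is added because Zorn_bigcup also considers the empty chain. *)
pose good P := P = set0 \/ [/\ sl_filter P, F `<=` P & forall a, P a -> ~ J a].
have [|P [goodP maxP]] := @Zorn_bigcup _ good.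
  move=> E Egood Etot.
  have [[Q EQ Q0]|E0] := pselect (exists2 Q, E Q & Q !=set0); last first.
    left; rewrite -subset0 => a [Q EQ Qa]; apply: E0.
    by exists Q => //; exists a.
  have goodE G a : E G -> G a ->
      [/\ sl_filter G, F `<=` G & forall a, G a -> ~ J a].
    by move=> /Egood [->|].
  right; have [q Qq] := Q0; have [[Q1 _ _] FQ _] := goodE _ _ EQ Qq.
  split=> [||a [G EG Ga]]; first split.
  - by exists Q.
  - move=> a b [G EG Ga] [H EH Hb].
    have [GH|HG] := Etot _ _ EG EH.
      exists H => //; have [[_ HI _] _ _] := goodE _ _ EH Hb.
      by apply: HI => //; exact: GH.
    exists G => //; have [[_ GI _] _ _] := goodE _ _ EG Ga.
    by apply: GI => //; exact: HG.
  - move=> a b ab [G EG Ga]; exists G => //.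
    by have [[_ _ GU] _ _] := goodE _ _ EG Ga; exact: GU Ga.
  - by move=> f Ff; exists Q => //; exact: FQ.
  - by have [_ _ GJ] := goodE _ _ EG Ga; exact: GJ.
have {goodP} [fP FP PJ] : [/\ sl_filter P, F `<=` P & forall a, P a -> ~ J a].
  case: goodP => // P0; exfalso; apply: (maxP F); last by right; split.
  (* The empty set is not maximal: [F] is good and contains the top. *)
  by case: fF => F1 _ _; rewrite P0; split=> // /(_ _ F1).
have [P1 PI PU] := fP; exists P; split=> //.
(* By maximality, the filter [Q] generated by [P] and an outside element [a] must meet [J]. *)
have meetJ a : ~ P a -> exists p b, [/\ P p, J b & a `&` p <= b].
  move=> Pa; apply: contrapT => noJ.
  pose Q := [set b | exists2 p, P p & a `&` p <= b].
  have PQ : P `<=` Q by move=> p Pp; exists p => //; exact: leIr.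
  apply: (maxP Q).
    split=> // QP; apply: Pa; apply: QP; exists \top => //; exact: leIl.
  right; split=> [||b [p Pp apb] Jb]; last by apply: noJ; exists p, b.
    split=> [|b c [p Pp apb] [q Pq aqc]|b c bc [p Pp apb]].
    - exact: PQ.
    - exists (p `&` q); first exact: PI.
      by rewrite lexI (le_trans _ apb) ?(le_trans _ aqc) // leI2 // ?leIl ?leIr.
    - by exists p => //; exact: le_trans bc.
  exact: subset_trans PQ.
split=> //; first by exists j => /PJ.
move=> a b /meetJ [p [a' [Pp Ja' apa']]] /meetJ [q [b' [Pq Jb' bqb']]].
have [f [c [Ff Jc a'c b'c]]] := Jdir _ _ Ja' Jb'.
(* Meeting with [p] and [q] brings [a] and [b] below elements of [J], and meeting with [f] then
   brings both below [c], which is outside [P] as a member of [J]. *)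
exists ((p `&` q) `&` f), c; split.
- by apply: (PI); [exact: PI|exact: FP].
- by move=> /PJ.
- apply: le_trans a'c; rewrite meetA; apply: leI2 => //.
  by apply: le_trans apa'; apply: leI2 => //; exact: leIl.
- apply: le_trans b'c; rewrite meetA; apply: leI2 => //.
  by apply: le_trans bqb'; apply: leI2 => //; exact: leIr.
Qed.

(** Separation from the singleton of [a], where the top serves as [f]. *)
Lemma irreducible_exists F a : sl_filter F -> ~ F a ->
  exists P, [/\ irreducible P, F `<=` P & ~ P a].
Proof.
move=> fF Fa; have [|b c -> ->|b Fb ba|P [iP FP PJ]] :=
  @irreducible_separation F [set a] fF.
- by exists a.
- by exists \top, a; case: fF => F1 _ _; split=> //; exact: leIl.
- by apply: Fa; rewrite -ba.
- by exists P; split=> // /PJ; exact.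
Qed.

Local Close Scope order_scope.

(** * The topology on irreducible filters *)

Definition irr_filter := {P : set A | irreducible P}.

HB.instance Definition _ := gen_eqMixin irr_filter.
HB.instance Definition _ := gen_choiceMixin irr_filter.

Implicit Type p q : irr_filter.

Definition beta a : set irr_filter := [set p | sval p a].

Definition irr_sub : set (set irr_filter) := [set ~` beta a | a in [set: A]].

HB.instance Definition _ :=
  isSubBaseTopological.Build irr_filter irr_sub id.

Lemma irr_subbase : subbase irr_sub.
Proof. by []. Qed.

Lemma irr_fil p : sl_filter (sval p).
Proof. by case: (svalP p). Qed.

Lemma irr_subC a : irr_sub (~` beta a).
Proof. by exists a. Qed.

Lemma cosub_irrP U : cosub irr_sub U <-> exists a, U = beta a.
Proof.
split=> [[_ [a _ <-] <-]|[a ->]]; first by exists a; rewrite setCK.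
by exists (~` beta a); rewrite ?setCK//; exact: irr_subC.
Qed.

Lemma betaI a b : beta (a `&` b)%O = beta a `&` beta b.
Proof.
apply/seteqP; split=> p /=; have [_ pI pU] := irr_fil p.
  by move=> pab; split; apply: pU pab; rewrite ?leIl ?leIr.
by case; exact: pI.
Qed.

Lemma betaT : beta \top%O = setT.
Proof. by apply/seteqP; split=> // p _; case: (irr_fil p). Qed.

(** If [a] is not below [b], some irreducible filter extends the principal filter of [a] and omits
    [b]. *)
Lemma beta_subset a b : beta a `<=` beta b <-> (a <= b)%O.
Proof.
split=> [ab|ab p]; last by have [_ _ pU] := irr_fil p; exact: pU ab.
apply: contrapT => nab.
have [||P [iP aP Pb]] := @irreducible_exists [set c | (a <= c)%O] b => //.
  by split=> [|c e ac ae|c e ce ac] /=; rewrite ?lex1 ?lexI ?ac ?ae ?(le_trans ac).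
by apply: Pb; apply: (ab (exist _ P iP)); apply: aP => /=.
Qed.

Lemma beta_inj : injective beta.
Proof.
by move=> a b ab; apply: le_anti; apply/andP; split; apply/beta_subset; rewrite ab.
Qed.

Lemma irr_open a : open (~` beta a).
Proof.
rewrite irr_subbase; exists [set ~` beta a]; last by rewrite bigcup_set1.
by move=> _ ->; apply: (@finI_from1 _ _ irr_sub id); exact: irr_subC.
Qed.

(** For an ultrafilter [E] containing the complement of [beta a], the [b] with [beta b] in [E] form
    a filter omitting [a]. An irreducible extension [P] omitting [a] is a limit of [E]: if [b] is
    not in [P], then [beta b] is not in [E], so its complement is. *)
Lemma irr_compact a : compact (~` beta a).
Proof.
rewrite compact_ultra => /= E EU Ea.
pose G := [set b | E (beta b)].
have fG : sl_filter G.
  split=> [|b c Gb Gc|b c bc Gb]; rewrite /G /=.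
  - by rewrite betaT; exact: filterT.
  - by rewrite betaI; exact: filterI.
  - by apply: filterS Gb; apply/beta_subset.
have Ga : ~ G a.
  move=> Ga; have : E set0 by rewrite -(setICr (beta a)); exact: filterI.
  exact: filter_not_empty.
have [P [iP GP Pa]] := irreducible_exists fG Ga.
exists (exist _ P iP); split=> // N; rewrite nbhsE => -[O [Oo OP] ON].
apply: filterS ON _; move: Oo OP; rewrite irr_subbase => -[D Dfin <-] [B DB BP].
apply: (@filterS _ _ _ B); first by move=> p Bp; exists B.
have [S SK SB] := Dfin _ DB; rewrite -SB in BP *.
apply: filter_bigI => V SV.
have /set_mem [b _ bV] := SK _ SV.
have [Eb|Eb] := in_ultra_setVsetC (beta b) EU.
  by exfalso; have := BP _ SV; rewrite /= -bV; apply; exact: GP.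
by rewrite -bV.
Qed.

Lemma irr_S_space : S_space irr_sub.
Proof.
split.
- exact: irr_subbase.
- move=> p q pq; apply: contrapT => sep; move/eqP: pq; apply.
  (* An element [a] in only one of the two filters separates them by the complement of [beta a]. *)
  apply: sig_eq; apply/seteqP; split=> a pa; apply: contrapT => qa; apply: sep;
    exists (~` beta a); [right|left]; split; rewrite inE /=; try exact;
    by apply: open_nbhs_nbhs; split=> //; exact: irr_open.
- apply/seteqP; split=> // p _; have [_ [a pa] _] := svalP p.
  by exists (~` beta a) => //; exact: irr_subC.
- by move=> _ [a _ <-]; split; [exact: irr_compact|exact: irr_open].
- move=> _ _ [a _ <-] [b _ <-]; rewrite -setCI -betaI; exact: irr_subC.
- by rewrite -setCT -betaT; exact: irr_subC.
- move=> _ _ p [a _ <-] [b _ <-] [pa pb].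
  have [_ _ /(_ _ _ pa pb)[f [c [pf pc afc bfc]]]] := svalP p.
  (* A filter that contains [f] and omits [c] contains neither [a] nor [b]. *)
  exists (~` beta f), (~` beta c); split; [exact: irr_subC|exact: irr_subC| | |].
  + exact.
  + exact: pc.
  + move=> q qc; have [_ qI qU] := irr_fil q.
    have [qf|] := pselect (sval q f); last by right.
    by left; split=> [qa|qb]; apply: qc; [apply: qU afc _|apply: qU bfc _];
      exact: qI.
- move=> Y J [D Dsub DY] [U JU] [JK Jdir] YJ.
  (* Via [beta], [Y] becomes the filter [F] and the [Y]-family [J] becomes the set [I]; a separating
     irreducible filter is the required point. *)
  pose F := [set a | Y `<=` beta a].
  pose I := [set a | J (beta a)].
  have [|||a|P [iP FP PI]] := @irreducible_separation F I.
  + split=> [|a b Fa Fb|a b ab Fa] /=; rewrite /F /=.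
    * by rewrite betaT.
    * by rewrite betaI subsetI.
    * exact/(subset_trans Fa)/beta_subset.
  + by have /cosub_irrP[a Ua] := JK _ JU; exists a; rewrite /I /= -Ua.
  + move=> a b Ia Ib; have [H [C [HK JC YH aH bH]]] := Jdir _ _ Ia Ib.
    have /cosub_irrP[f Hf] := HK; have /cosub_irrP[c Cc] := JK _ JC.
    exists f, c; rewrite /F /I /= -Hf -Cc.
    by split=> //; apply/beta_subset; rewrite betaI -Hf -Cc.
  + by move=> Fa /YJ [p [/Fa]].
  exists (exist _ P iP); split.
    rewrite -DY => V DV; have /cosub_irrP[a Va] := Dsub _ DV.
    by rewrite Va; apply: FP; rewrite /F /= -DY -Va => p; exact.
  move=> V JV; have /cosub_irrP[a Va] := JK _ JV.
  by rewrite Va => /PI; apply; rewrite /I /= -Va.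
Qed.

Lemma irr_sub_saturated V : irr_sub V -> subbasic_saturated irr_sub V.
Proof.
move=> KV; exists [set V]; split; rewrite ?bigcap_set1//; first by move=> _ ->.
by move=> _ _ -> ->; exists V.
Qed.

(** * The relation induced by a monotone operation *)

Variables (m : A -> A) (m_homo : {homo m : a b / (a <= b)%O}).

(** The largest relation into saturated sets whose [mrel] sends each [beta a] to a superset of
    [beta (m a)]. *)
Definition irr_rel p : set (set irr_filter) :=
  [set Z | subbasic_saturated irr_sub Z /\
           forall a, sval p (m a) -> Z `&` beta a !=set0].

Lemma mrel_irr a : mrel irr_rel (beta a) = beta (m a).
Proof.
apply/seteqP; split=> p /=; last by move=> pma Z [_]; exact.
move=> pR; apply: contrapT => pma.
(* The complement of [beta a] belongs to [irr_rel p]: if it missed [beta b] with [m b] in [p], then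
   [b] would be below [a], and [m a] would be in [p]. *)
have [|q [qa /qa]//] := pR (~` beta a).
split=> [|b pmb]; first exact/irr_sub_saturated/irr_subC.
apply: contrapT => disj; apply: pma; have [_ _ pU] := irr_fil p.
apply: pU pmb; apply: m_homo; apply/beta_subset => q qb.
by apply: contrapT => qa; apply: disj; exists q.
Qed.

Lemma irr_mS_space : mS_space irr_sub irr_rel.
Proof.
split=> [|p Z []//|U /cosub_irrP[a ->]|p].
- exact: irr_S_space.
- by rewrite mrel_irr; apply/cosub_irrP; exists (m a).
- apply/seteqP; split=> Z [satZ hit]; split=> //.
    by move=> U [/cosub_irrP[a ->]]; rewrite mrel_irr => /hit.
  move=> a pma; have [] // := hit (beta a).
  by split; [apply/cosub_irrP; exists a|rewrite mrel_irr].
Qed.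
End irreducible_filters.

(** * Essential surjectivity *)

Section beta_iso.
Variable A : monotone_semilattice.

Definition irr_space : mSspace := MSSpace (irr_mS_space (@msl_opP A)).

Definition beta_map (a : A) : cosub_mMS irr_space :=
  exist _ (beta a) ((cosub_irrP _).2 (ex_intro _ a erefl)).

Lemma beta_map_hom : monotone_hom beta_map.
Proof.
split=> [a b||a]; apply: sig_eq; [exact: betaI|exact: betaT|].
by rewrite /= mrel_irr//; exact: msl_opP.
Qed.
End beta_iso.

Lemma bijective_monotone_hom_iso (A B : mMS) (h : mMS_hom A B) (g : B -> A) :
  cancel (sval h) g -> cancel g (sval h) -> @is_iso mMS A B h.
Proof.
move=> hK gK; have [hI h1 hm] := svalP h.
have gP : monotone_hom g.
  split=> [a b||a]; apply: (can_inj hK); rewrite gK.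
  - by rewrite hI !gK.
  - by rewrite h1.
  - by rewrite hm gK.
by exists (exist _ g gP); apply/sig_eq/funext => a /=; rewrite ?hK ?gK.
Qed.

Lemma cosub_fun_esurj (A : mMS) :
  exists X (f : Hom A (cosub_fun X)), is_iso f.
Proof.
exists (irr_space A), (exist _ (@beta_map A) (@beta_map_hom A)).
(* The inverse of [beta_map] chooses a preimage, unique by [beta_inj]. *)
have beta_surj (U : cosub_mMS (irr_space A)) : exists a, beta_map a = U.
  by have /cosub_irrP[a Ua] := svalP U; exists a; exact: sig_eq.
apply: (@bijective_monotone_hom_iso _ _ _ (fun U => projT1 (cid (beta_surj U)))).
  move=> a; have /(congr1 sval) := projT2 (cid (beta_surj (beta_map a))).
  by move=> /(@beta_inj _ A).
by move=> U; exact: projT2 (cid (beta_surj U)).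
Qed.

Theorem theorem7 : dually_equivalent mSp mMS.
Proof.
apply: (@fully_faithful_equivalent _ _ cosub_fun).
- exact: cosub_fun_faithful.
- exact: cosub_fun_full.
- exact: cosub_fun_esurj.
Qed.
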